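(* Let $X$ be a nonempty Tychonoff space. The following are equivalent. (a) $X$ is hemicompact. (b) $\mathbb K(X)$ is hemicompact. (c) $\mathbb K(X)$ is $\sigma$-compact. (d) $C_k(X)$ is metrizable. (e) $C_k(X)$ is first-countable. (f) One has a winning predetermined strategy in $G_1(\mathcal N[K(X)],\neg\mathcal K_X)$. (g) Two has a winning Markov strategy in $G_1(\mathcal K_X,\mathcal K_X)$. (h) One has a winning predetermined strategy in $G_1(\mathcal N_{\mathbf 0},\neg\Gamma_{C_k(X),\mathbf 0})$. (i) One has a winning predetermined strategy in $G_1(\mathcal N_{\mathbf 0},\neg\Omega_{C_k(X),\mathbf 0})$. (j) One has a winning predetermined strategy in $G_1(\mathcal T_{C_k(X)},CD_{C_k(X)})$. (k) Two has a winning Markov strategy in $G_1(\Omega_{C_k(X),\mathbf 0},\Omega_{C_k(X),\mathbf 0})$. (l) Two has a winning Markov strategy in $G_1(\mathcal D_{C_k(X)},\Omega_{C_k(X),\mathbf 0})$.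
   Context: Spaces. $C_k(X)$ is the set of continuous functions $X\to\mathbb R$ with the topology of uniform convergence on compact subsets of $X$ (the compact-open topology); $\mathbf 0$ is the zero function. $K(X)$ is the family of nonempty compact subsets of $X$, and $\mathbb K(X)$ is $K(X)$ with the Vietoris topology, generated by the sets $\{K\in K(X):K\subseteq U\}$ and $\{K\in K(X):K\cap U\neq\emptyset\}$ for $U\subseteq X$ open. A space is hemicompact if it has a sequence of compact subsets $K_n$ such that every compact subset is contained in some $K_n$. Covers. An open cover of $X$ is a collection $\mathcal U$ of open sets with $\bigcup\mathcal U=X$ and $X\notin\mathcal U$ (all open covers are nontrivial). A $k$-cover is an open cover $\mathcal U$ such that every compact $K\subseteq X$ is contained in some $U\in\mathcal U$. $\mathcal K_X$ is the collection of all $k$-covers of $X$. For $A\subseteq X$, $\mathcal N(A)$ is the set of open $U\subsetneq X$ with $A\subseteq U$, and $\mathcal N[K(X)]=\{\mathcal N(K):K\in K(X)\}$; so in a game with first argument $\mathcal N[K(X)]$ One plays a compact set $K$ and Two answers with an open set $U\supseteq K$, $U\ne X$. Families in a space $Y$ with $y\in Y$. $\mathcal T_Y$: nonempty open subsets of $Y$. $\mathcal D_Y$: dense subsets of $Y$. $CD_Y$: closed and discrete subsets of $Y$. $\Omega_{Y,y}$: sets $A\subseteq Y$ with $y\in\overline{A}$. $\Gamma_{Y,y}$: sequences in $Y$ converging to $y$. $\mathcal N_{\mathbf 0}$: all open neighborhoods of $\mathbf 0$ in $C_k(X)$. Games. In $G_1(\mathcal A,\mathcal B)$, in each round $n\in\omega$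 One plays $A_n\in\mathcal A$ and Two answers with $B_n\in A_n$; Two wins if $\{B_n:n\in\omega\}\in\mathcal B$, otherwise One wins. In $G_1(\mathcal A,\neg\mathcal B)$ Two wins if $\{B_n:n\in\omega\}\notin\mathcal B$, otherwise One wins (for $\mathcal B=\Gamma_{Y,y}$, membership means that the sequence $(B_n)_{n\in\omega}$ converges to $y$). A player who has no legal move loses. A predetermined strategy for One is a function of the round number only; a Markov strategy for Two is a function of One's most recent move and the round number only. A strategy is winning if its owner wins every play in which it is followed. *)

(* Defs.v *)
From HB Require Import structures.
From mathcomp Require Import all_boot all_order all_algebra.
From mathcomp Require Import all_classical all_reals all_analysis.

Set Implicit Arguments.
Unset Strict Implicit.
Unset Printing Implicit Defensive.

Import Order.TTheory GRing.Theory Num.Theory.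
Import numFieldNormedType.Exports.

Local Open Scope classical_set_scope.
Local Open Scope ring_scope.

Section Spaces.

(* [completely_regular_space] is phrased with uniformities; [uniform_separatorP]
   is its equivalence with separation by functions into [0, 1]. *)
Definition tychonoff_space (T : topologicalType) : Prop :=
  completely_regular_space T /\ hausdorff_space T.

Definition hemicompact (T : topologicalType) : Prop :=
  exists K : nat -> set T, (forall n, compact (K n)) /\
    forall C : set T, compact C -> exists n, C `<=` K n.

Definition sigma_compact (T : topologicalType) : Prop :=
  exists K : nat -> set T, (forall n, compact (K n)) /\ \bigcup_n K n = setT.

Definition first_countable (T : topologicalType) : Prop :=
  forall x : T, exists B : nat -> set T, (forall n, nbhs x (B n)) /\
    forall U : set T, nbhs x U -> exists n, B n `<=` U.

Definition metrizable (R : realType) (T : topologicalType) : Prop :=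
  exists d : T -> T -> R,
    [/\ forall x y, 0 <= d x y,
        forall x y, d x y = 0 <-> x = y,
        forall x y, d x y = d y x,
        forall x y z, d x z <= d x y + d y z &
        forall x : T, nbhs x = nbhs_ball_ (fun x e => [set y | d x y < e]) x].

End Spaces.

Section FunctionSpace.
Variables (X : topologicalType) (R : realType).

Definition Ck : Type := continuousType X R.

HB.instance Definition _ := Choice.copy Ck (continuousType X R).

(* The compact-open topology of the library lives on all functions X -> R; [Ck]
   gets the subspace topology. *)
HB.instance Definition _ := Topological.copy Ck
  (initial_topology (fun f : continuousType X R => (f : {compact-open, X -> R}))).

Definition Ck0 : Ck := (cst 0 : continuousType X R).

End FunctionSpace.

Section Hyperspace.
Variable X : topologicalType.

Definition ncompacts : set (set X) := [set K | compact K /\ K !=set0].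

Definition vietoris : Type := {K : set X | ncompacts K}.

HB.instance Definition _ := gen_eqMixin vietoris.
HB.instance Definition _ := gen_choiceMixin vietoris.

Definition vietoris_subbase : set (set vietoris) :=
  [set [set K : vietoris | sval K `<=` U] | U in open] `|`
  [set [set K : vietoris | sval K `&` U !=set0] | U in open].

HB.instance Definition _ :=
  isSubBaseTopological.Build vietoris vietoris_subbase id.

End Hyperspace.

Section Families.

Definition open_cover (X : topologicalType) : set (set (set X)) :=
  [set C | [/\ C `<=` open, \bigcup_(U in C) U = setT & ~ C setT]].

Definition k_cover (X : topologicalType) : set (set (set X)) :=
  [set C | open_cover C /\
    forall K : set X, compact K -> exists2 U, C U & K `<=` U].

Definition proper_nbhds (X : topologicalType) (A : set X) : set (set X) :=
  [set U | [/\ open U, U <> setT & A `<=` U]].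

Definition compact_nbhds (X : topologicalType) : set (set (set X)) :=
  [set proper_nbhds K | K in @ncompacts X].

Definition nonempty_open (Y : topologicalType) : set (set Y) :=
  [set U | open U /\ U !=set0].

Definition closed_discrete (Y : topologicalType) : set (set Y) :=
  [set D | closed D /\ D `<=` isolated D].

Definition clustering (Y : topologicalType) (y : Y) : set (set Y) :=
  [set A | closure A y].

Definition converging (Y : topologicalType) (y : Y) : set (nat -> Y) :=
  [set b | b n @[n --> \oo] --> y].

End Families.

(* [G1 A W]: One chooses members of [A], Two answers with elements of them, and
   [W] is the set of infinite sequences of answers with which Two wins.  Hence
   G_1(A, B) is [G1 A (seqs B)] and G_1(A, not B) is [G1 A (~` seqs B)].
   A player who cannot move loses.  Since a strategy must always give legal
   moves, only the opponent of its owner can get stuck in a play that follows it,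
   so the strategy is winning as soon as its owner wins the infinite plays.  In
   particular One has no strategy when [A] is empty, One wins by ever playing
   [set0], and Two has no strategy when [A set0]. *)
Section Games.
Variable T : Type.

Definition seqs (B : set (set T)) : set (nat -> T) := [set b | B (range b)].

Record game := G1 { one_moves : set (set T); two_wins : set (nat -> T) }.

Definition One_pre_wins (G : game) : Prop :=
  exists s : nat -> set T, (forall n, one_moves G (s n)) /\
    forall b : nat -> T, (forall n, s n (b n)) -> ~ two_wins G b.

Definition Two_mark_wins (G : game) : Prop :=
  exists t : set T -> nat -> T,
    (forall A n, one_moves G A -> A (t A n)) /\
    forall a : nat -> set T, (forall n, one_moves G (a n)) ->
      two_wins G (fun n => t (a n) n).

End Games.

(* Main.v *)
Require Import Defs.
From HB Require Import structures.
From mathcomp Require Import all_boot all_order all_algebra.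
From mathcomp Require Import finmap lra.
From mathcomp Require Import all_classical all_reals all_analysis.

Set Implicit Arguments.
Unset Strict Implicit.
Unset Printing Implicit Defensive.

Import Order.TTheory GRing.Theory Num.Theory.
Import numFieldNormedType.Exports.

Local Open Scope classical_set_scope.

(** Every condition is compared with hemicompactness of [X], that is, with the
existence of a sequence [K n] of compact sets absorbing all compact sets.

From such a sequence, made increasing ([hemicompact_exhaustion]), everything is
built directly.  In the hyperspace, the compact subsets of [K n] form a compact
set ([compact_vietoris_powerset]), and these sets absorb every compact family
because the union of a compact family of compact sets is compact
([compact_vietoris_union]).  In the function space, the neighbourhoods
[|f| < 1/(n+1) on K n] of zero are such that every sequence picked from them
converges to zero ([hemicompact_selections]); One wins the neighbourhood games
by playing them, One wins the closed discrete game by playing them with zero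
removed, and Two wins the clustering games by answering from them.  Truncated
suprema over the [K n] give a metric ([Ck_metrizable]).  In the covering game,
One plays the [K n].

The converses all say that countably many compact sets cannot control [X] unless
they absorb all compact sets.  If [K n] does not, one compact set [C] contains a
point [x n] outside each [K n].  On the covering side, the complements of the
points [x n] are answers of Two none of which contains [C].  On the function
side, each nonempty open set is determined near one of its members by the values
on some compact set [K n]; complete regularity allows to redefine this member at
[x n] at will ([escaping_selection]).  Giving the value [1] at [x n] keeps the
picks away from zero uniformly on [C], and giving the value [n] makes them
unbounded on [C], hence a closed discrete set.

Finally, a Markov strategy of Two is turned into moves of One by a diagonal
argument: if, in round [n], Two avoided some answer under each move of One, these
avoided answers would make up a k-cover (or a dense set) from which Two could not
answer ([Two_wins_One_wins_k_cover], [Two_wins_dense_hemicompact]). *)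

(** * Compactness in the hyperspace *)

Section Hyperspace.
Variable X : topologicalType.

Lemma open_vietoris_sub (U : set X) :
  open U -> open [set K : vietoris X | sval K `<=` U].
Proof.
move=> oU; exists [set [set K : vietoris X | sval K `<=` U]].
  move=> _ ->; exists (fset1 [set K : vietoris X | sval K `<=` U]).
    by move=> _ /[!inE] ->; left; exists U.
  by rewrite set_fset1 bigcap_set1.
by rewrite bigcup_set1.
Qed.

Lemma vietoris_cvgP (F : set_system (vietoris X)) (K : vietoris X) :
  Filter F ->
  (forall U, open U -> sval K `<=` U -> F [set L | sval L `<=` U]) ->
  (forall U, open U -> sval K `&` U !=set0 ->
     F [set L | sval L `&` U !=set0]) ->
  F --> K.
Proof.
move=> FF Fsub Fmeet A [_ [[D Dsub <-] [B DB BK] BA]].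
apply: filterS BA _; apply: (@filterS _ _ _ B); first by move=> ? ?; exists B.
have [E Esub EB] := Dsub _ DB; rewrite -EB in BK *.
apply: filter_bigI => S ES; have /set_mem := Esub _ ES.
have := BK _ ES => /= SK [] [U oU SE]; rewrite -SE /= in SK *.
- exact: Fsub.
- exact: Fmeet.
Qed.

(** The tube lemma: near coverings of a compact set only concern its points, but
one open set around it can be chosen that works for all nearby indices.  The
trick is to apply near covering to the small members of the filter instead of to
its indices, so that the openness of the tube is part of the covered property. *)
Lemma compact_nbhs_tube (I : Type) (F : set_system I) (P : I -> X -> Prop)
    (K : set X) :
  Filter F -> compact K ->
  (forall x, K x -> \forall x' \near x & i \near F, P i x') ->
  exists2 U, open U /\ K `<=` U & \forall i \near F, U `<=` P i.
Proof.
move=> FF /compact_near_coveringP cK PK.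
have [F0|nF0] := pselect (F set0).
  by exists setT; [split=> //; exact: openT | apply: filterS F0].
have PF : ProperFilter F by [].
pose Q (A : set I) := [set x | forall i, A i -> P i x]°.
have : \forall A \near powerset_filter_from F, K `<=` Q A.
  apply: (cK (set I) (powerset_filter_from F) Q) => x.
  move=> /PK [[V A] /= [Vx FA] VAP].
  exists (V°, [set B | F B /\ B `<=` A]) => /=.
    by split; [exact: nbhs_interior | exact: powerset_filter_fromP].
  move=> [y B] /= [Vy [FB BA]]; apply: filterS Vy => z Vz i Bi.
  by apply: (VAP (z, i)); split=> //; exact: BA.
case/(near_powerset_filter_fromP F) => [A B AB KQB x /KQB|A FA KQA].
  by apply: interiorS => z Bz i /AB; exact: Bz.
exists (Q A); first by split; [exact: open_interior | exact: KQA].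
by apply: filterS FA => i Ai x /interior_subset; exact.
Qed.

(** A tube around each member [K] of the family contains all members near [K],
so the compactness of the family itself finishes the argument. *)
Lemma compact_vietoris_union (C : set (vietoris X)) :
  compact C -> compact (\bigcup_(K in C) sval K).
Proof.
move=> /compact_near_coveringP cC.
apply/compact_near_coveringP => I F P FF PC.
have : \forall i \near F, C `<=` [set K | sval K `<=` P i].
  apply: cC => K CK.
  have [|U [oU KU] FU] := compact_nbhs_tube (P := P) FF (proj1 (svalP K)).
    by move=> x Kx; apply: PC; exists K.
  exists ([set L | sval L `<=` U], [set i | U `<=` P i]) => /=.
    by split=> //; apply: open_nbhs_nbhs; split=> //; exact: open_vietoris_sub.
  by move=> [L i] /= [LU UP]; exact: subset_trans UP.
by apply: filterS => i CP x [K /CP]; exact.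
Qed.

(** An ultrafilter of compact subsets of [K] converges to the set of the points
of [K] all of whose neighbourhoods are met by almost all of these subsets. *)
Lemma compact_vietoris_powerset (K : set X) : hausdorff_space X ->
  compact K -> compact [set L : vietoris X | sval L `<=` K].
Proof.
move=> hX cK; rewrite compact_ultra => F UF FK.
pose hits (U : set X) := [set L : vietoris X | sval L `&` U !=set0].
have miss (M : set X) : compact M ->
    (forall x, M x -> exists2 U, open_nbhs x U & ~ F (hits U)) ->
    F [set L | sval L `<=` ~` M].
  move=> /compact_near_coveringP cM noM.
  have : \forall L \near F, M `<=` ~` sval L.
    apply: cM => x /noM [U oU nU]; exists (U, ~` hits U).
      split; first exact: open_nbhs_nbhs.
      by have [|] := in_ultra_setVsetC (hits U) UF.
    by move=> [y L] /= [Uy nL] Ly; apply: nL; exists y.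
  by apply: filterS => L ML x Lx /ML.
pose L0 := K `&` [set x | forall U, open_nbhs x U -> F (hits U)].
have clK : closed K by exact: compact_closed.
have cL0 : compact L0.
  apply: compact_closedI => //; rewrite -[X in closed X]setCK closedC openE => x.
  move=> /existsNP[U /not_implyP[[oU Ux] nFU]].
  apply: (filterS _ (open_nbhs_nbhs (conj oU Ux))).
  by move=> y Uy /(_ U (conj oU Uy)).
have out x : K x -> ~ L0 x -> exists2 U, open_nbhs x U & ~ F (hits U).
  move=> Kx nL0x; apply: contrapT => no; apply: nL0x; split=> // U oU.
  by apply: contrapT => nF; apply: no; exists U.
have L0n0 : L0 !=set0.
  apply/set0P/eqP => L00.
  have /filterI/(_ FK)/filter_ex : F [set L | sval L `<=` ~` K].
    by apply: miss => // x Kx; apply: out => //; rewrite L00.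
  by move=> [L [/= LnK LK]]; have [_ [x Lx]] := svalP L; exact: LnK (LK _ Lx).
exists (exist _ L0 (conj cL0 L0n0)); split; first by move=> x [].
apply: vietoris_cvgP => U oU /=.
- (* almost all members miss the compact set of the points of K outside U *)
  move=> L0U; have : F [set L | sval L `<=` ~` (K `&` ~` U)].
    apply: miss; first by apply: compact_closedI => //; rewrite closedC.
    by move=> x [Kx nUx]; apply: out => // /L0U.
  apply: filterS2 FK => L /= LK LU x Lx; apply: contrapT => nUx.
  by apply: (LU x Lx); split=> //; exact: LK.
- by move=> [x [[_ Lx] Ux]]; exact: Lx.
Qed.

End Hyperspace.

(** * Hemicompact spaces and their hyperspaces *)

Section Hemicompact.
Variable X : topologicalType.

Lemma not_hemicompact (K : nat -> set X) : ~ hemicompact X ->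
  (forall n, compact (K n)) ->
  exists2 C, compact C & exists x : nat -> X, forall n, C (x n) /\ ~ K n (x n).
Proof.
move=> nhX cK; apply: contrapT => no; apply: nhX; exists K; split=> // C cC.
apply: contrapT => nC; apply: no; exists C => //.
have /choice[x xP] n : exists y, C y /\ ~ K n y.
  by apply: nonsubset => CK; apply: nC; exists n.
by exists x.
Qed.

(** The point [x0] makes all the sets nonempty, as required of moves in the
covering game and of the index sets of suprema. *)
Lemma hemicompact_exhaustion (x0 : X) : hemicompact X ->
  exists K : nat -> set X,
  [/\ forall n, compact (K n), forall n, K n x0,
      forall m n, (m <= n)%N -> K m `<=` K n &
      forall C, compact C -> \forall n \near \oo, C `<=` K n].
Proof.
move=> [K [cK exK]].
exists (fun n => [set x0] `|` \big[setU/set0]_(i < n.+1) K i); split.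
- move=> n; apply: compactU; first exact: compact_set1.
  by apply: bigsetU_compact.
- by move=> n; left.
- by move=> m n mn; apply: setUS; exact: subset_bigsetU.
- move=> C /exK [N CN]; exists N => // n /= Nn x /CN KNx; right.
  by rewrite -bigcup_mkord; exists N.
Qed.

Lemma hemicompact_sigma_compact : hemicompact X -> sigma_compact X.
Proof.
move=> [K [cK exK]]; exists K; split=> //; rewrite -subTset => x _.
by have [n xK] := exK _ (@compact_set1 _ x); exists n => //; exact: xK.
Qed.

Lemma hemicompact_vietoris : hausdorff_space X ->
  hemicompact X -> hemicompact (vietoris X).
Proof.
move=> hX [K [cK exK]].
exists (fun n => [set L | sval L `<=` K n]); split=> [n|C cC].
  exact: compact_vietoris_powerset.
have [n CK] := exK _ (compact_vietoris_union cC).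
by exists n => L CL x Lx; apply: CK; exists L.
Qed.

(** A compact set of [X] is a single point of the hyperspace: covering the points
of the hyperspace is enough to absorb the compact sets of [X]. *)
Lemma sigma_compact_vietoris_hemicompact :
  sigma_compact (vietoris X) -> hemicompact X.
Proof.
move=> [C [cC CT]].
exists (fun n => \bigcup_(L in C n) sval L); split=> [n|K cK].
  exact: compact_vietoris_union.
have [->|/set0P K0] := eqVneq K set0; first by exists 0%N.
have [n _ CK] : (\bigcup_n C n) (exist _ K (conj cK K0)) by rewrite CT.
by exists n => x Kx; exists (exist _ K (conj cK K0)).
Qed.

End Hemicompact.

(** * The compact-open topology *)

Local Open Scope ring_scope.

Section CompactOpen.
Variables (X : topologicalType) (R : realType).
Implicit Types (f g : Ck X R) (K : set X) (e : R).

Definition unif_ball f K e : set (Ck X R) :=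
  [set g | forall x, K x -> `|f x - g x| < e].

Definition Ck_of (h : X -> R) (ch : continuous h) : Ck X R :=
  (mkcts ch : continuousType X R).

Lemma Ck_continuous f : continuous (f : X -> R).
Proof. exact: cts_fun. Qed.

Lemma nbhs_unif_ball f K e : compact K -> 0 < e -> nbhs f (unif_ball f K e).
Proof.
move=> cK e0.
have cf : continuous (f : X -> R) by exact: Ck_continuous.
have /(compact_open_fam_compactP cf) :
    {compact-open, nbhs (f : {compact-open, X -> R}) --> (f : X -> R)} by [].
move=> /fam_cvgP /(_ K cK).
move=> /(_ [set h | forall x, K x -> `|f x - h x| < e]) fK.
apply: (@initial_continuous _ _
  (fun g : continuousType X R => (g : {compact-open, X -> R}))).
apply: fK; apply/uniform_nbhs; exists [set p | ball p.1 e p.2]; split.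
  by rewrite -entourage_ballE; exists e.
by move=> h /= hK x Kx; exact: hK.
Qed.

(** Near a continuous function, the compact-open topology is that of uniform
convergence on compact sets, so the balls generate a filter which converges to
[f] in the compact-open topology and therefore contains its neighbourhoods. *)
Lemma nbhs_CkP f (A : set (Ck X R)) :
  nbhs f A <-> exists K e, [/\ compact K, 0 < e & unif_ball f K e `<=` A].
Proof.
split; last first.
  by move=> [K [e [cK e0 KeA]]]; apply: filterS KeA (nbhs_unif_ball _ cK e0).
have cf : continuous (f : X -> R) by exact: Ck_continuous.
move=> [_ [[B oB <-] Bf BA]].
pose F : set_system (X -> R) := filter_from
  [set p : set X * R | compact p.1 /\ 0 < p.2]
  (fun p => [set h | forall x, p.1 x -> `|f x - h x| < p.2]).
have FF : Filter F.
  apply: filter_from_filter.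
    by exists (set0, 1) => /=; split=> //; exact: compact0.
  move=> [K d] [L e] /= [cK d0] [cL e0]; exists (K `|` L, Num.min d e) => /=.
    by split; [exact: compactU | rewrite lt_min d0].
  by move=> h /= hKL; split=> x ?; (have := hKL x); rewrite lt_min;
    [move=> /(_ (or_introl _))|move=> /(_ (or_intror _))] => /(_ _)/andP[].
have : {compact-open, F --> (f : X -> R)}.
  apply/(compact_open_fam_compactP cf)/fam_cvgP => K cK S.
  move=> /uniform_nbhs[E [+ ES]].
  rewrite -entourage_ballE => -[e /= e0 eE]; exists (K, e) => // h /= hK.
  by apply: ES => x Kx; apply: eE; exact: hK.
have /[swap] /[apply] : nbhs (f : {compact-open, X -> R}) B.
  exact: open_nbhs_nbhs.
move=> [[K e] /= [cK e0] KB]; exists K, e.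
by split=> // g gK; apply: BA; exact: KB.
Qed.

Lemma Ck_accessible : accessible_space (Ck X R).
Proof.
move=> f g /eqP fg; exists (~` [set g]).
split; rewrite ?inE ?openE //=.
move=> h /= hg; apply/nbhs_CkP.
have [y hy] : exists y, h y != g y.
  apply: contrapT => no; apply: hg; apply/continuousEP => y.
  by apply: contrapT => /eqP ?; apply: no; exists y.
exists [set y], `|h y - g y|; split; first exact: compact_set1.
  by rewrite normr_gt0 subr_eq0.
by move=> k /(_ y erefl) + kg; rewrite kg ltxx.
Qed.

Lemma Ck_redefine f K y c : tychonoff_space X -> compact K -> ~ K y ->
  exists g, (forall x, K x -> g x = f x) /\ g y = c.
Proof.
move=> [crX hX] cK nKy.
have /(@uniform_separatorP _ R)[p [cp _ p0 p1]] :=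
  crX y K (compact_closed hX cK) nKy.
have ch : continuous (fun x => f x + (c - f y) * (1 - p x)).
  move=> x; apply: cvgD; first exact: Ck_continuous.
  by apply: cvgMr; apply: cvgB; [exact: cvg_cst | exact: cp].
exists (Ck_of ch); split=> [x Kx|]; rewrite /= /mkcts.
  have -> : p x = 1 by apply: p1; exists x.
  by rewrite subrr mulr0 addr0.
have -> : p y = 0 by apply: p0; exists y.
by rewrite subr0 mulr1 addrC subrK.
Qed.

(** The common reason for all the converse implications on the function side.
Each [W n] only constrains its members on one compact set, which misses a point
of [C]; there the value can be prescribed. *)
Lemma escaping_selection (W : nat -> set (Ck X R)) : tychonoff_space X ->
  ~ hemicompact X -> (forall n, nonempty_open (W n)) ->
  exists2 C : set X, compact C & forall c : nat -> R,
    exists b : nat -> Ck X R,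
    forall n, W n (b n) /\ exists2 x, C x & b n x = c n.
Proof.
move=> tX nhX oW.
have /choice[K WK] n : exists K, compact K /\ exists f, forall g,
    (forall x, K x -> g x = f x) -> W n g.
  have [oWn [f Wf]] := oW n.
  have /nbhs_CkP[K [e [cK e0 KeW]]] : nbhs f (W n) by exact: open_nbhs_nbhs.
  exists K; split=> //; exists f => g gf; apply: KeW => x Kx.
  by rewrite gf// subrr normr0.
have [C cC [x xP]] := not_hemicompact nhX (fun n => proj1 (WK n)).
exists C => // c.
have /choice[b Wb] n : exists b, W n b /\ exists2 x, C x & b x = c n.
  have [Cx nKx] := xP n; have [cK [f fW]] := WK n.
  have [g [gf gx]] := Ck_redefine f (c n) tX cK nKx.
  by exists g; split; [exact: fW | exists (x n)].
by exists b.
Qed.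

Lemma hemicompact_selections : [set: X] !=set0 -> hemicompact X ->
  exists W : nat -> set (Ck X R),
  (forall n, open_nbhs (Ck0 X R) (W n)) /\
  forall b, (forall n, W n (b n)) -> b n @[n --> \oo] --> Ck0 X R.
Proof.
move=> [x0 _] /(hemicompact_exhaustion x0)[K [cK _ _ exK]].
exists (fun n => (unif_ball (Ck0 X R) (K n) n.+1%:R^-1)°); split=> [n|b Wb].
  split; first exact: open_interior.
  by apply: nbhs_unif_ball => //; rewrite invr_gt0 ltr0n.
move=> A /nbhs_CkP[C [e [cC e0 CeA]]].
have := near_infty_natSinv_lt (PosNum e0) : \forall n \near \oo, n.+1%:R^-1 < e.
apply: filterS2 (exK C cC) => n CK ne; apply: CeA => x /CK Kx.
have /(_ x Kx) bx := interior_subset (Wb n); exact: lt_trans bx ne.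
Qed.

End CompactOpen.

(** * Metrizability and first countability *)

Section Metric.
Variables (X : topologicalType) (R : realType) (K : nat -> set X) (x0 : X).
Hypotheses (cK : forall n, compact (K n)) (Kx0 : forall n, K n x0)
  (leK : forall m n, (m <= n)%N -> K m `<=` K n)
  (exK : forall C, compact C -> \forall n \near \oo, C `<=` K n).

(** The truncation at [1/(n+1)] makes all but finitely many of the seminorms
irrelevant for a given precision, and the supremum finite. *)
Let terms (f g : Ck X R) : set R :=
  [set Num.min p.1.+1%:R^-1 `|f p.2 - g p.2| | p in [set p | K p.1 p.2]].

Let dist f g := sup (terms f g).

Let terms_ub f g : has_ubound (terms f g).
Proof.
exists 1 => _ [[n x] _ <-] /=; rewrite ge_min; apply/orP; left.
by rewrite invf_le1 ?ler1n// ltr0n.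
Qed.

Let terms0 f g : terms f g !=set0.
Proof. by eexists; exists (0%N, x0). Qed.

Let le_dist (f g : Ck X R) n x :
  K n x -> Num.min n.+1%:R^-1 `|f x - g x| <= dist f g.
Proof. by move=> Kx; apply: (ub_le_sup (terms_ub f g)); exists (n, x). Qed.

Let dist_le (f g : Ck X R) c :
  (forall n x, K n x -> Num.min n.+1%:R^-1 `|f x - g x| <= c) -> dist f g <= c.
Proof.
by move=> fgc; apply: (ge_sup (terms0 f g)) => _ [[n x] Kx <-]; exact: fgc.
Qed.

Let inv_gt0 n : 0 < n.+1%:R^-1 :> R.
Proof. by rewrite invr_gt0 ltr0n. Qed.

Let dist_ge0 f g : 0 <= dist f g.
Proof.
apply: le_trans (le_dist f g (Kx0 0)).
by rewrite le_min normr_ge0 ltW.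
Qed.

Lemma Ck_metrizable : metrizable R (Ck X R).
Proof.
exists dist; split.
- exact: dist_ge0.
- move=> f g; split=> [fg0|->]; last first.
    apply/eqP; rewrite eq_le dist_ge0 andbT.
    by apply: dist_le => n x _; rewrite subrr normr0 ge_min lexx orbT.
  apply/continuousEP => x; apply/eqP; rewrite -subr_eq0 -normr_le0.
  have [N _ /(_ N (leqnn N))/(_ x erefl) KNx] := exK (@compact_set1 _ x).
  have := le_dist f g KNx; rewrite fg0 ge_min => /orP[|//].
  by rewrite leNgt inv_gt0.
- move=> f g; congr sup; apply: eq_imagel => p _.
  by rewrite distrC.
- move=> f g h; apply: dist_le => n x Kx.
  apply: le_trans (lerD (le_dist f g Kx) (le_dist g h Kx)).
  have := ler_distD (g x) (f x) (h x).
  set u := `|f x - g x|; set v := `|g x - h x| => uv.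
  have [u0 v0] : 0 <= u /\ 0 <= v by split; exact: normr_ge0.
  have := inv_gt0 n; set a := n.+1%:R^-1 => a0.
  by case: (lerP a `|f x - h x|); case: (lerP a u); case: (lerP a v); lra.
- move=> f; apply/seteqP; split=> A.
    move=> /nbhs_CkP[C [e [cC e0 CeA]]].
    have [N _ /(_ N (leqnn N)) CN] := exK cC.
    (* below 1/(N+1), the truncation of the N-th seminorm is not active *)
    exists (Num.min N.+1%:R^-1 e); first by rewrite /= lt_min inv_gt0.
    move=> g /= fg; apply: CeA => x /CN Kx.
    have := le_lt_trans (le_dist f g Kx) fg.
    rewrite lt_min => /andP[]; rewrite !gt_min ltxx /= => fgN.
    by move=> /orP[|//]; exact: lt_trans fgN.
  move=> [e /= e0 eA]; apply/nbhs_CkP.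
  have [N _ /(_ N (leqnn N)) /= Ne] :=
    near_infty_natSinv_lt (PosNum (divr_gt0 e0 (ltr0n _ 2))).
  exists (K N), (e / 2); split=> //; first exact: divr_gt0.
  (* e/2 leaves room for the supremum, which need not be attained *)
  move=> g fg; apply: eA => /=; apply: (@le_lt_trans _ _ (e / 2)); last by lra.
  apply: dist_le => n x Kx; rewrite ge_min.
  have [nN|Nn] := leqP n N.
    by rewrite (ltW (fg x (leK nN Kx))) orbT.
  apply/orP; left; apply: le_trans (ltW Ne).
  by rewrite lef_pV2 ?posrE ?ltr0n// ler_nat ltnS ltnW.
Qed.

End Metric.

Lemma metrizable_first_countable (R : realType) (T : topologicalType) :
  metrizable R T -> first_countable T.
Proof.
move=> [d [_ _ _ _ nbhsd]] x; exists (fun n => [set y | d x y < n.+1%:R^-1]).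
split=> [n|U]; rewrite nbhsd.
  by exists n.+1%:R^-1 => //=; rewrite invr_gt0 ltr0n.
move=> [e /= e0 eU].
have [N _ /(_ N (leqnn N)) /= Ne] := near_infty_natSinv_lt (PosNum e0).
by exists N => y /= xy; apply: eU; exact: lt_trans Ne.
Qed.

(** * Sequences and their ranges *)

Lemma cvg_range_closure (T : topologicalType) (b : nat -> T) y :
  b n @[n --> \oo] --> y -> closure (range b) y.
Proof.
move=> b_y V /b_y[N _ /(_ N (leqnn N)) bN].
by exists (b N); split=> //; exists N.
Qed.

Lemma closed_discrete_range (T : topologicalType) (b : nat -> T) :
  accessible_space T ->
  (forall p : T, exists2 V : set T, nbhs p V &
     exists N, forall n, V (b n) -> (n < N)%N) ->
  closed_discrete (range b).
Proof.
move=> T1 finb.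
have sep (p : T) : exists2 V : set T, nbhs p V & V `&` range b `<=` [set p].
  have [V pV [N VN]] := finb p.
  pose A := b @` `I_N `\ p.
  have clA : closed A.
    move/accessible_finite_set_closed : T1; apply.
    by apply: finite_setD; exact: finite_image.
  exists (V `&` ~` A).
    apply: filterI => //; apply: open_nbhs_nbhs; split; first by rewrite openC.
    by move=> [_ np]; exact: np.
  move=> q [[Vb nAb] [n _ bn]]; apply: contrapT => bp; apply: nAb; split=> //.
  by exists n => //=; apply: VN; rewrite bn.
split=> [p clp|p bp].
  have [V pV Vb] := sep p; have [q [bq Vq]] := clp V pV.
  by rewrite -(Vb q (conj Vq bq)).
split; first exact/mem_set.
have [V pV Vb] := sep p; exists V => //; apply/seteqP; split=> // q ->.
by split=> //; exact: nbhs_singleton.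
Qed.

(** * Markov strategies *)

Lemma Two_mark_wins_sub (T : Type) (A A' : set (set T)) (W : set (nat -> T)) :
  A' `<=` A -> Two_mark_wins (G1 A W) -> Two_mark_wins (G1 A' W).
Proof.
move=> sA [t [tA tW]]; exists t; split=> [B n /= AB|a /= Aa].
  exact: (tA B n (sA B AB)).
by apply: (tW a) => n; exact: (sA _ (Aa n)).
Qed.

(** Two answers in round [n] with a member of [P n]: this depends on the last
move and the round only.  The point [t0] is the answer to illegal moves. *)
Lemma Two_mark_wins_within (T : Type) (A : set (set T)) (W : set (nat -> T))
    (P : nat -> set T) (t0 : T) :
  (forall B n, A B -> B `&` P n !=set0) ->
  (forall b, (forall n, P n (b n)) -> W b) -> Two_mark_wins (G1 A W).
Proof.
move=> AP PW.
have /choice[t tP] (p : set T * nat) : exists x, A p.1 -> p.1 x /\ P p.2 x.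
  have [/(AP p.1 p.2)[x ?]|nA] := pselect (A p.1); first by exists x.
  by exists t0.
exists (fun B n => t (B, n)); split=> [B n /(tP (B, n))[]//|a Aa].
by apply: PW => n; have [] := tP (a n, n) (Aa n).
Qed.

(** * The games on k-covers *)

Section KCoverGames.
Variable X : topologicalType.

Lemma k_cover_of_compacts (C : set (set X)) : C `<=` open -> ~ C setT ->
  (forall K, compact K -> exists2 U, C U & K `<=` U) -> k_cover C.
Proof.
move=> oC nCT kC; split=> //; split=> //; rewrite -subTset => x _.
have [U CU xU] := kC _ (@compact_set1 _ x).
by exists U => //; exact: xU.
Qed.

Lemma hemicompact_One_wins_k_cover (x0 : X) : hemicompact X ->
  One_pre_wins (G1 (@compact_nbhds X) (~` seqs (@k_cover X))).
Proof.
move=> /(hemicompact_exhaustion x0)[K [cK Kx0 _ exK]].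
exists (fun n => proper_nbhds (K n)); split=> [n|b Kb].
  by exists (K n) => //; split=> //; exists x0.
apply; apply: k_cover_of_compacts => [_ [n _ <-]|[n _ bT]|C cC].
- by case: (Kb n).
- by case: (Kb n) => _ /(_ bT).
- have [N _ /(_ N (leqnn N)) CN] := exK C cC.
  by exists (b N); [exists N | case: (Kb N) => _ _; exact: subset_trans].
Qed.

Lemma One_wins_k_cover_hemicompact : hausdorff_space X ->
  One_pre_wins (G1 (@compact_nbhds X) (~` seqs (@k_cover X))) -> hemicompact X.
Proof.
move=> hX [s [sK win]]; apply: contrapT => nhX.
have /choice[K Ks] n : exists K, ncompacts K /\ s n = proper_nbhds K.
  by have [K cK <-] := sK n; exists K.
have [C cC [x xP]] := not_hemicompact nhX (fun n => proj1 (proj1 (Ks n))).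
have [|] := win (fun n => ~` [set x n]).
  move=> n; have [_ ->] := Ks n; split.
  - by rewrite openC; exact: accessible_closed_set1 (hausdorff_accessible hX) _.
  - by move=> xT; have : [set: X] (x n) by []; rewrite -xT; exact.
  - by move=> y Ky yx; have [_] := xP n; rewrite -yx.
move=> /= [_ /(_ C cC)[_ [n _ <-]] CU].
by have [/CU/(_ erefl)] := xP n.
Qed.

Lemma One_wins_Two_wins_k_cover :
  One_pre_wins (G1 (@compact_nbhds X) (~` seqs (@k_cover X))) ->
  Two_mark_wins (G1 (@k_cover X) (seqs (@k_cover X))).
Proof.
move=> [s [sK win]].
apply: (@Two_mark_wins_within _ _ _ s set0) => [|b /win/contrapT//].
move=> B n [[oB _ nBT] kB]; have [K [cK _] <-] := sK n.
have [U BU KU] := kB K cK; exists U; split=> //; split=> //; first exact: oB.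
by move=> UT; apply: nBT; rewrite -UT.
Qed.

(** In each round [n] there is a compact [K] all of whose proper neighbourhoods
are answers of Two to some k-cover.  Otherwise every compact [K] would have a
neighbourhood [U K] which is never an answer in round [n], although the [U K]
form a k-cover that Two must answer. *)
Lemma Two_wins_One_wins_k_cover (x0 : X) :
  Two_mark_wins (G1 (@k_cover X) (seqs (@k_cover X))) ->
  One_pre_wins (G1 (@compact_nbhds X) (~` seqs (@k_cover X))).
Proof.
move=> [t [tA win]].
have /choice[K KP] n : exists K, ncompacts K /\
    forall U, proper_nbhds K U -> exists2 A, k_cover A & t A n = U.
  apply: contrapT => no.
  have /choice[U UP] K : exists U, ncompacts K ->
      proper_nbhds K U /\ forall A, k_cover A -> t A n <> U.
    have [cK|ncK] := pselect (ncompacts K); last by exists set0.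
    apply: contrapT => noU; apply: no; exists K; split=> // V KV.
    apply: contrapT => nV; apply: noU; exists V => _; split=> // A kA tV.
    by apply: nV; exists A.
  pose A := [set U K | K in @ncompacts X].
  have kA : k_cover A.
    apply: k_cover_of_compacts.
    - by move=> _ [K /UP[[oU _ _] _] <-].
    - by move=> [K /UP[[_ nT _] _]].
    move=> K cK.
    (* x0 is added since the empty compact set is not a move of One *)
    have cK' : ncompacts (K `|` [set x0]).
      split; last by exists x0; right.
      by apply: compactU => //; exact: compact_set1.
    exists (U (K `|` [set x0])); first by exists (K `|` [set x0]).
    by have [[_ _ KU] _] := UP _ cK'; move=> x Kx; apply: KU; left.
  by have [K /UP[_ /(_ A kA) nU]] := tA A n kA; move/esym/nU.
exists (fun n => proper_nbhds (K n)); split=> [n|b Kb].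
  by exists (K n) => //; have [] := KP n.
apply.
have /choice[A AP] n : exists A, k_cover A /\ t A n = b n.
  by have [_ /(_ _ (Kb n))[A ? ?]] := KP n; exists A.
have -> : b = fun n => t (A n) n by apply/funext => n; have [_] := AP n.
by apply: win => n; have [] := AP n.
Qed.

End KCoverGames.

(** * The games on the function space *)

Section HemicompactFromGames.
Variables (X : topologicalType) (R : realType).
Hypothesis tX : tychonoff_space X.
Local Notation Ck0 := (Ck0 X R).

(** Otherwise a selection could take the value [1] somewhere on a fixed compact
set, and stay out of a ball around zero. *)
Lemma clustering_selections_hemicompact (W : nat -> set (Ck X R)) :
  (forall n, nonempty_open (W n)) ->
  (forall b, (forall n, W n (b n)) -> closure (range b) Ck0) -> hemicompact X.
Proof.
move=> oW clW; apply: contrapT => nhX.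
have [C cC /(_ (cst 1))[b bP]] := escaping_selection tX nhX oW.
have [_ [[n _ <-]] bC] :=
  clW b (fun n => proj1 (bP n)) _ (nbhs_unif_ball Ck0 cC ltr01).
have [_ [x /bC + bx]] := bP n.
by rewrite bx sub0r normrN normr1 ltxx.
Qed.

Lemma first_countable_hemicompact : first_countable (Ck X R) -> hemicompact X.
Proof.
move=> /(_ Ck0)[B [nB BP]].
apply: (@clustering_selections_hemicompact (fun n => (B n)°)) => [n|b Bb].
  by split; [exact: open_interior | exists Ck0; exact: nB].
move=> V /BP[n BV]; exists (b n); split; first by exists n.
exact: BV _ (interior_subset (Bb n)).
Qed.

Lemma One_wins_clustering_hemicompact :
  One_pre_wins (G1 (open_nbhs Ck0) (~` seqs (clustering Ck0))) -> hemicompact X.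
Proof.
move=> [s [s0 win]].
apply: (@clustering_selections_hemicompact s) => [n|b sb].
  by have [? ?] := s0 n; split=> //; exists Ck0.
by apply: contrapT => /(win b sb).
Qed.

(** The set [E n] of the answers of Two in round [n] has nonempty interior, since
otherwise its complement would be dense and Two could not answer it.  Sequences
picked from these interiors are plays of Two, so they cluster at zero. *)
Lemma Two_wins_dense_hemicompact :
  Two_mark_wins (G1 (@dense (Ck X R)) (seqs (clustering Ck0))) -> hemicompact X.
Proof.
move=> [t [tD win]]; pose E n := [set t D n | D in @dense (Ck X R)].
have EW n : nonempty_open (E n)°.
  split; first exact: open_interior.
  apply: contrapT => E0.
  have dE : dense (~` E n).
    move=> O [f Of] oO; apply: contrapT => OE; apply: E0.
    exists f; apply: (filterS _ (open_nbhs_nbhs (conj oO Of))) => g Og.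
    by apply: contrapT => nEg; apply: OE; exists g.
  by apply: (tD _ n dE); exists (~` E n).
apply: clustering_selections_hemicompact EW _ => b Eb.
have /choice[D DP] n : exists D, dense D /\ t D n = b n.
  by have [D ? ?] := interior_subset (Eb n); exists D.
have -> : b = fun n => t (D n) n by apply/funext => n; have [_] := DP n.
by apply: win => n; have [] := DP n.
Qed.

(** Otherwise Two could answer with functions [b n] taking the value [n] on a
fixed compact set [C]; a ball of radius [1] on [C] around any function contains
only finitely many of them, because that function is bounded on [C]. *)
Lemma One_wins_closed_discrete_hemicompact :
  One_pre_wins
    (G1 (@nonempty_open (Ck X R)) (seqs (@closed_discrete (Ck X R)))) ->
  hemicompact X.
Proof.
move=> [s [os win]]; apply: contrapT => nhX.
have [C cC /(_ (fun n => n%:R))[b bP]] := escaping_selection tX nhX os.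
apply: (win b (fun n => proj1 (bP n))).
apply: closed_discrete_range; first exact: Ck_accessible.
move=> p; exists (unif_ball p C 1); first exact: nbhs_unif_ball.
have : compact ((p : X -> R) @` C).
  apply: continuous_compact => //; apply: continuous_subspaceT.
  exact: Ck_continuous.
move=> /compact_bounded[M [_ /(_ (M + 1))]].
rewrite ltrDl ltr01 => /(_ isT) pM.
exists (Num.truncn (M + 2)).+1 => n pb.
have [_ [x Cx bx]] := bP n.
have /= pMx := pM (p x) (ex_intro2 _ _ x Cx erefl).
have := pb x Cx; rewrite bx => px.
rewrite -(ltr_nat R); apply: lt_trans (truncnS_gt _).
by move: px; rewrite ltr_distlC => /andP[_ ?]; have := ler_norm (p x); lra.
Qed.

End HemicompactFromGames.

Section GamesFromHemicompact.
Variables (X : topologicalType) (R : realType).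
Hypothesis X0 : [set: X] !=set0.
Local Notation Ck0 := (Ck0 X R).

Lemma hemicompact_One_wins_converging : hemicompact X ->
  One_pre_wins (G1 (open_nbhs Ck0) (~` converging Ck0)).
Proof.
move=> /(hemicompact_selections R X0)[W [W0 Wcvg]].
by exists W; split=> // b /Wcvg ?; exact.
Qed.

Lemma One_wins_converging_clustering :
  One_pre_wins (G1 (open_nbhs Ck0) (~` converging Ck0)) ->
  One_pre_wins (G1 (open_nbhs Ck0) (~` seqs (clustering Ck0))).
Proof.
move=> [s [s0 win]]; exists s; split=> // b sb; apply.
by apply: cvg_range_closure; apply: contrapT => /(win b sb).
Qed.

Lemma hemicompact_Two_wins_clustering : hemicompact X ->
  Two_mark_wins (G1 (clustering Ck0) (seqs (clustering Ck0))).
Proof.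
move=> /(hemicompact_selections R X0)[W [W0 Wcvg]].
apply: (@Two_mark_wins_within _ _ _ W Ck0) => [B n B0|b /Wcvg].
  exact/B0/open_nbhs_nbhs.
exact: cvg_range_closure.
Qed.

Lemma dense_clustering : @dense (Ck X R) `<=` clustering Ck0.
Proof.
move=> D dD V V0.
have [|f [/interior_subset Vf Df]] := dD _ _ (open_interior V).
  by exists Ck0.
by exists f.
Qed.

(** The answers converge to zero, which One excludes from all moves: their range
is not closed. *)
Lemma hemicompact_One_wins_closed_discrete : hemicompact X ->
  One_pre_wins
    (G1 (@nonempty_open (Ck X R)) (seqs (@closed_discrete (Ck X R)))).
Proof.
move=> /(hemicompact_selections R X0)[W [W0 Wcvg]].
exists (fun n => W n `\ Ck0); split=> [n|b Wb].
  split.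
    apply: openI; first by have [] := W0 n.
    by rewrite openC; exact: accessible_closed_set1 (@Ck_accessible X R) _.
  have /nbhs_CkP[K [e [_ e0 KeW]]] := open_nbhs_nbhs (W0 n).
  exists (cst (e / 2) : continuousType X R); split.
    apply: KeW => x _ /=; rewrite sub0r normrN gtr0_norm ?divr_gt0//.
    by rewrite ltr_pdivrMr// ltr_pMr// ltr1n.
  have [x _] := X0; move=> /continuousEP /(_ x) /= e20.
  by move: (divr_gt0 e0 (ltr0n R 2)); rewrite e20 ltxx.
have b0 := cvg_range_closure (Wcvg b (fun n => proj1 (Wb n))).
by move=> [clb _]; have [n _ bn0] := clb _ b0; have [_] := Wb n; exact.
Qed.

End GamesFromHemicompact.

(** * The equivalences *)

Theorem theorem40 (R : realType) (X : topologicalType)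
    (X_nonempty : [set: X] !=set0) (X_tychonoff : tychonoff_space X) :
  [<-> (* a *) hemicompact X;
       (* b *) hemicompact (vietoris X);
       (* c *) sigma_compact (vietoris X);
       (* d *) metrizable R (Ck X R);
       (* e *) first_countable (Ck X R);
       (* f *) One_pre_wins (G1 (@compact_nbhds X) (~` seqs (@k_cover X)));
       (* g *) Two_mark_wins (G1 (@k_cover X) (seqs (@k_cover X)));
       (* h *) One_pre_wins
                 (G1 (open_nbhs (Ck0 X R)) (~` converging (Ck0 X R)));
       (* i *) One_pre_wins
                 (G1 (open_nbhs (Ck0 X R)) (~` seqs (clustering (Ck0 X R))));
       (* j *) One_pre_wins
                 (G1 (@nonempty_open (Ck X R))
                     (seqs (@closed_discrete (Ck X R))));
       (* k *) Two_mark_wins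
                 (G1 (clustering (Ck0 X R)) (seqs (clustering (Ck0 X R))));
       (* l *) Two_mark_wins
                 (G1 (@dense (Ck X R)) (seqs (clustering (Ck0 X R))))].
Proof.
have hX : hausdorff_space X := proj2 X_tychonoff.
have [x0 _] := X_nonempty.
tfae.
- exact: hemicompact_vietoris.
- exact: hemicompact_sigma_compact.
- move=> /sigma_compact_vietoris_hemicompact /(hemicompact_exhaustion x0).
  by move=> [K [cK Kx0 leK exK]]; exact: (Ck_metrizable R cK Kx0 leK exK).
- exact: metrizable_first_countable.
- move=> /(first_countable_hemicompact X_tychonoff).
  exact: hemicompact_One_wins_k_cover.
- exact: One_wins_Two_wins_k_cover.
- move=> /(Two_wins_One_wins_k_cover x0) /(One_wins_k_cover_hemicompact hX).
  exact: hemicompact_One_wins_converging.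
- exact: One_wins_converging_clustering.
- move=> /(One_wins_clustering_hemicompact X_tychonoff).
  exact: hemicompact_One_wins_closed_discrete.
- move=> /(One_wins_closed_discrete_hemicompact X_tychonoff).
  exact: hemicompact_Two_wins_clustering.
- exact: Two_mark_wins_sub (@dense_clustering X R).
- exact: Two_wins_dense_hemicompact.
Qed.
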